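(* Let $\kappa<\lambda<\mu<\nu$ be regular cardinals. Then (1) $Ref(\nu,\mu,\lambda)$ and $Ref(\nu,\lambda,\kappa)$ together imply $Ref(\nu,\mu,\kappa)$; and (2) $Ref(\nu,\mu,\kappa)$ and $Ref(\mu,\lambda,\kappa)$ together imply $Ref(\nu,\lambda,\kappa)$.
   Context: For regular $\kappa<\lambda$, $T^\lambda_\kappa = \{\alpha<\lambda : {\rm cf}(\alpha)=\kappa\}$. For regular $\kappa<\lambda<\mu$: $Ref(\mu,\lambda,\kappa)$ means that for every stationary $S\subseteq T^\mu_\kappa$ there is $\alpha\in T^\mu_\lambda$ with $S\cap\alpha$ stationary in $\alpha$. *)

(* Defs.v *)
From mathcomp Require Import all_boot all_order.
From mathcomp Require Import wochoice boolp classical_sets cardinality.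

Set Implicit Arguments.
Unset Strict Implicit.
Unset Printing Implicit Defensive.

Local Open Scope order_scope.
Local Open Scope classical_set_scope.

(* The ordinals are the elements of an arbitrary well-ordered type [O]
   (hypothesis [well_order <=%O] of the theorems).  Such an [O] is isomorphic
   to a unique ordinal theta, its elements being the ordinals below theta.
   Every notion below at [a : O] is determined by the elements [<= a] and does not
   depend on how far [O] extends above [a]. *)

Section Ordinals.
Context {d : Order.disp_t} {O : orderType d}.
Implicit Types (a b c k l m : O) (A C S : set O).

(* The von Neumann identification of an ordinal with its set of predecessors. *)
Definition seg a : set O := [set b | b < a].

Definition limit_ordinal a : Prop :=
  seg a !=set0 /\ forall b, b < a -> exists2 c, b < c & c < a.

(* The inequality [b <= c] is weak so that the cofinality of a successor is 1;
   for [a] a limit it may equivalently be made strict. *)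
Definition cofinal_in a A : Prop :=
  A `<=` seg a /\ forall b, b < a -> exists2 c, A c & b <= c.

Definition has_cofinal_map a k : Prop :=
  exists f : O -> O, cofinal_in a (f @` seg k).

(* [cofinality a k] is cf(a) = k; [has_cofinal_map a a] always holds, so the
   least such [k] exists. *)
Definition cofinality a k : Prop :=
  has_cofinal_map a k /\ forall b, has_cofinal_map a b -> k <= b.

Definition is_cardinal a : Prop :=
  forall b, b < a -> ~ (seg a #<= seg b)%card.

Definition regular_cardinal a : Prop :=
  [/\ is_cardinal a, infinite_set (seg a) & cofinality a a].

Definition closed_in a C : Prop :=
  forall b, b < a -> limit_ordinal b -> cofinal_in b (C `&` seg b) -> C b.

Definition club_in a C : Prop := cofinal_in a C /\ closed_in a C.

Definition stationary_in a S : Prop :=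
  S `<=` seg a /\ forall C, club_in a C -> S `&` C !=set0.

(* [Tcof l k] is T^l_k. *)
Definition Tcof l k : set O := [set a | a < l /\ cofinality a k].

Definition Ref m l k : Prop :=
  forall S, S `<=` Tcof m k -> stationary_in m S ->
    exists2 a, Tcof m l a & stationary_in a (S `&` seg a).

End Ordinals.

(* Main.v *)
(* Let acc(A) be the set of limit points of A; below an ordinal of uncountable
   cofinality the limit points of two unbounded sets form a club.

   For (1), Ref(nu,lambda,kappa) applied to S intersected with an arbitrary club
   shows that T = {b in T^nu_lambda : S reflects at b} is stationary; where T
   reflects, so does S, by testing stationarity of T on acc(C).

   For (2), let S reflect at a of cofinality mu and let h : mu -> a be continuous,
   weakly increasing and cofinal.  Let E be the set of limit x with h(z) < h(x) for
   all z < x.  At x in E, h preserves cofinality, and S is stationary in h(x) iff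
   {z in E : h(z) in S} is stationary in x.  This pulls S back from a to mu, where
   it reflects at some y, and h(y) is the required point. *)
Require Import Defs.
From mathcomp Require Import all_boot all_order.
From mathcomp Require Import wochoice boolp classical_sets cardinality.

Set Implicit Arguments.
Unset Strict Implicit.
Unset Printing Implicit Defensive.

Import Order.TTheory.

Local Open Scope order_scope.
Local Open Scope classical_set_scope.

Section WellOrder.
Context {d : Order.disp_t} {O : orderType d}.
Context (O_wo : well_order (<=%O : rel O)).
Implicit Types (a b c k x y z : O) (A B C D S : set O) (g h : O -> O).

(** * Least elements, limit points and uncountable cofinality *)

Lemma wo_least A : A !=set0 -> exists2 x, A x & forall y, A y -> x <= y.
Proof.
move=> [x0 Ax0].
have [|z [[Az minz] _]] := O_wo (A := [pred x | `[< A x >]]).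
  by exists x0; apply/asboolP.
exists z; first exact/asboolP.
by move=> y Ay; apply: minz; apply/asboolP.
Qed.

(** Both inequalities are strict and [b] is nonzero, so every such point is a limit ordinal; [A] may
    extend beyond [b]. *)
Definition acc A : set O := [set b | seg b !=set0 /\
  forall c, c < b -> exists u, [/\ A u, c < u & u < b]].

Lemma acc_limit A b : acc A b -> limit_ordinal b.
Proof. by case=> b0 Ab; split=> // c /Ab [u [_ cu ub]]; exists u. Qed.

Lemma acc_cofinal A b : acc A b -> cofinal_in b (A `&` seg b).
Proof.
case=> b0 Ab; split=> [x []//|c /Ab [u [Au cu ub]]].
by exists u; [split | exact: ltW].
Qed.

Lemma cofinal_acc A b : limit_ordinal b -> cofinal_in b (A `&` seg b) -> acc A b.
Proof.
move=> [b0 bl] [_ Ab]; split=> // c /bl [e ce /Ab [u [Au ub] eu]].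
by exists u; split=> //; exact: lt_le_trans eu.
Qed.

Lemma sub_acc A B b : A `<=` B -> acc A b -> acc B b.
Proof.
by move=> AB [b0 Ab]; split=> // c /Ab [u [Au cu ub]]; exists u; split=> //; apply: AB.
Qed.

Lemma closed_acc a C b : closed_in a C -> b < a -> acc C b -> C b.
Proof. by move=> cC ba Cb; apply: cC (acc_limit Cb) (acc_cofinal Cb). Qed.

(* Limit ordinals of uncountable cofinality: taking [f] constant excludes successors. *)
Definition ucof a := seg a !=set0 /\
  forall f : nat -> O, (forall n, f n < a) -> exists2 b, b < a & forall n, f n < b.

Lemma ucof_limit a : ucof a -> limit_ordinal a.
Proof.
case=> a0 ua; split=> // b ba.
by have [c ca bc] := ua (fun=> b) (fun=> ba); exists c => //; exact: (bc 0).
Qed.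

(** A sequence unbounded in [a], composed with a surjection from [seg l] onto [nat], would be a
    cofinal map of length [l < k]. *)
Lemma cofinality_ucof a k l :
  infinite_set (seg l) -> l < k -> cofinality a k -> ucof a.
Proof.
move=> /infiniteP/pcard_surjP [g gs] lk [_ kmin]; split.
  apply/set0P/eqP => a0.
  have: has_cofinal_map a a.
    exists id; split=> [_ [x xa <-]//|b ba].
    by have: seg a b by []; rewrite a0.
  move=> /kmin ka; have: seg a l by exact: lt_le_trans ka.
  by rewrite a0.
move=> f fa; apply: contrapT => nb.
suff /kmin : has_cofinal_map a l by rewrite leNgt lk.
exists (f \o g); split=> [_ [x _ <-]|b ba]; first exact: fa.
apply: contrapT => nc; apply: nb; exists b => // n.
rewrite ltNge; apply/negP => bn; apply: nc.
by have [x lx gx] := gs n I; exists (f n) => //; exists x; rewrite //= gx.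
Qed.

Lemma cofinal_gt a A b : limit_ordinal a -> cofinal_in a A -> b < a ->
  exists u, [/\ A u, b < u & u < a].
Proof.
move=> [_ la] [sA cA] /la [c bc /cA [u Au cu]].
by exists u; split=> //; [exact: lt_le_trans cu | exact: sA].
Qed.

(* Interleave elements of [A] and [B] in an omega-sequence; its supremum is below [a]. *)
Lemma club_acc a A B : ucof a -> cofinal_in a A -> cofinal_in a B ->
  club_in a (acc A `&` acc B `&` seg a).
Proof.
move=> ua cA cB; have la := ucof_limit ua.
split; last first.
  move=> b ba lb cb; have lbb := lb; have [b0 _] := lb.
  have acb := cofinal_acc lb cb.
  split=> //; split; split=> // c cb'; case: acb => _ /(_ _ cb') [u [[[[_ uA] [_ uB]] _] cu ub]].
    by have [v [Av cv vu]] := uA _ cu; exists v; split=> //; exact: lt_trans ub.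
  by have [v [Av cv vu]] := uB _ cu; exists v; split=> //; exact: lt_trans ub.
split=> [x []//|b ba].
have step x : exists y, x < a -> [/\ y < a,
    exists u, [/\ A u, x < u & u < y] & exists u, [/\ B u, x < u & u < y]].
  case: (ltP x a) => xa; last by exists x.
  have [u [Au xu ua']] := cofinal_gt la cA xa.
  have [v [Bv xv va]] := cofinal_gt la cB xa.
  have [y uvy ya] : exists2 y, Order.max u v < y & y < a.
    by case: la => _; apply; rewrite gt_max ua' va.
  move: uvy; rewrite gt_max => /andP[uy vy].
  by exists y => _; split=> //; [exists u | exists v].
have [s sP] := choice step.
pose f n := iter n s b.
have fa n : f n < a by elim: n => //= n /sP [].
have [e0 e0a fe0] := ua.2 f fa.
have [e fe mine] : exists2 e, forall n, f n < e &
    forall y, (forall n, f n < y) -> e <= y.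
  by apply: (wo_least (A := fun e => forall n, f n < e)); exists e0.
have ea : e < a by apply: le_lt_trans e0a; exact: mine.
have le c : c < e -> exists n, c <= f n.
  move=> ce; apply: contrapT => nc.
  suff /mine : forall n, f n < c by rewrite leNgt ce.
  by move=> n; rewrite ltNge; apply/negP => cf; apply: nc; exists n.
have e_0 : seg e !=set0 by exists b; exact: (fe 0).
exists e; last by exact/ltW/(fe 0).
split=> //; split; split=> // c /le [n cn].
  have [_ [u [Au fu uf]] _] := sP _ (fa n).
  exists u; split=> //; first exact: le_lt_trans fu.
  exact: lt_trans uf (fe n.+1).
have [_ _ [u [Au fu uf]]] := sP _ (fa n).
exists u; split=> //; first exact: le_lt_trans fu.
exact: lt_trans uf (fe n.+1).
Qed.

(** * Stationary sets and their traces *)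

Lemma stationary_cofinal a S : stationary_in a S -> cofinal_in a S.
Proof.
move=> [sS St]; split=> // b ba.
(* The test set is the final segment from [b], which is a club. *)
have [|x [Sx [xa bx]]] := St [set x | x < a /\ b <= x]; last by exists x.
split.
  split=> [x []//|c ca].
  exists (Order.max b c); last by rewrite le_max lexx orbT.
  by split; rewrite ?gt_max ?ba ?ca // le_max lexx.
move=> c ca [[x xc] _] [_ /(_ _ xc) [y [[ya yb] yc] _]].
by split=> //; apply: le_trans yb _; exact: ltW.
Qed.

(** Closed sets contain their limit points, so the club of common limit points of [C] and a test
    club lies in both. *)
Lemma stationaryIclub a S C : ucof a -> stationary_in a S -> club_in a C ->
  stationary_in a (S `&` C).
Proof.
move=> ua [sS St] [cC clC]; split=> [x [/sS]//|D [cD clD]].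
have [x [Sx [[Cx Dx] xa]]] := St _ (club_acc ua cC cD).
exists x; split; first by split=> //; exact: closed_acc clC xa Cx.
exact: closed_acc clD xa Dx.
Qed.

Lemma stationary_trace a S T : ucof a ->
  (forall b, T b -> ucof b /\ stationary_in b (S `&` seg b)) ->
  stationary_in a (T `&` seg a) -> stationary_in a (S `&` seg a).
Proof.
move=> ua TS [_ St]; split=> [x []//|C [cC clC]].
have [b [[Tb _] [[Cb _] ba]]] := St _ (club_acc ua cC cC).
have [ub [_ Sb]] := TS _ Tb.
(* [Cb] makes [C] unbounded in [b], so its limit points form a club in [b], which [S] meets. *)
have [x [[Sx xb] [[Cx _] _]]] :=
  Sb _ (club_acc ub (acc_cofinal Cb) (acc_cofinal Cb)).
have xa : x < a by exact: lt_trans ba.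
exists x; split=> //; apply: closed_acc clC xa _.
by apply: sub_acc Cx => y [].
Qed.

(** * Transfer along a continuous weakly increasing map *)

Section Continuous.
Context (h : O -> O) (m : O).
Context (h_mono : forall x y, x <= y -> y <= m -> h x <= h y).
(** Given [h_mono], [h x] is the supremum of the earlier values at each limit [x], the endpoint [m]
    included. *)
Context (h_cont : forall x b, x <= m -> limit_ordinal x -> b < h x ->
  exists2 z, z < x & b < h z).

(** At any other limit up to [m] the map is constant on a final stretch, so its value may have a
    different cofinality. *)
Definition strict_limit : set O :=
  [set x | limit_ordinal x /\ forall z, z < x -> h z < h x].

Lemma h_lt x y : x <= m -> y <= m -> h x < h y -> x < y.
Proof. by move=> xm ym; apply: contraTT; rewrite -!leNgt => yx; exact: h_mono. Qed.

Lemma strict_limit_img x : x <= m -> strict_limit x -> limit_ordinal (h x).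
Proof.
move=> xm [lx sx]; split.
  by have [[z zx] _] := lx; exists (h z); exact: sx.
by move=> b /(h_cont xm lx) [z zx bz]; exists (h z) => //; exact: sx.
Qed.

Lemma strict_limit_closed x : x <= m -> acc strict_limit x -> strict_limit x.
Proof.
move=> xm ax; split; first exact: acc_limit ax.
move=> z zx; have [u [[_ us] zu ux]] := ax.2 _ zx.
by apply: lt_le_trans (us _ zu) _; apply: h_mono xm; exact: ltW.
Qed.

(** Composing with [h] carries cofinal maps up; conversely each value [f i] is replaced by a point
    that [h] sends above it. *)
Lemma has_cofinal_map_img x k : x <= m -> strict_limit x ->
  has_cofinal_map (h x) k <-> has_cofinal_map x k.
Proof.
move=> xm sx; have [lx hx] := sx; split=> -[f [fs fc]].
  have gP i : exists z, i < k -> z < x /\ f i < h z.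
    have [ik|ik] := ltP i k; last by exists x.
    have [|z zx fz] := h_cont xm lx (b := f i); last by exists z.
    by apply: fs; exists i.
  have [g gk] := choice gP.
  exists g; split=> [_ [i ik <-]|z zx]; first by have [] := gk _ ik.
  have [_ [i ik <-] zi] := fc _ (hx _ zx).
  have [gx fg] := gk _ ik.
  exists (g i); first by exists i.
  apply/ltW/h_lt; [exact: le_trans (ltW zx) xm|exact: le_trans (ltW gx) xm|].
  exact: le_lt_trans fg.
exists (h \o f); split=> [_ [i ik <-]|b bx].
  by apply: hx; apply: fs; exists i.
have [z zx bz] := h_cont xm lx bx.
have [_ [i ik <-] zi] := fc _ zx.
exists (h (f i)); first by exists i.
apply: le_trans (ltW bz) _; apply: h_mono => //.
by apply: le_trans xm; apply/ltW/fs; exists i.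
Qed.

Lemma cofinality_img x k : x <= m -> strict_limit x ->
  cofinality (h x) k <-> cofinality x k.
Proof.
move=> xm sx; split=> -[kc kmin]; split=> [|b bc].
- exact/(has_cofinal_map_img k xm sx).
- by apply: kmin; apply/(has_cofinal_map_img b xm sx).
- exact/(has_cofinal_map_img k xm sx).
- by apply: kmin; apply/(has_cofinal_map_img b xm sx).
Qed.

(* [x] is the least point that [h] sends to [c] or above. *)
Lemma acc_img_preimage y D c : y <= m -> D `<=` seg y -> c < h y ->
  acc (h @` D) c -> exists x, [/\ x < y, strict_limit x, h x = c & acc D x].
Proof.
move=> ym Dy cy [c0 Dc].
have [x [xy cx] minx] : exists2 x, x <= y /\ c <= h x &
    forall z, z <= y /\ c <= h z -> x <= z.
  by apply: (wo_least (A := fun x => x <= y /\ c <= h x)); exists y; split=> //; exact: ltW.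
have xm : x <= m by exact: le_trans ym.
have below z : z < x -> h z < c.
  move=> zx; rewrite ltNge; apply/negP => cz.
  suff : x <= z by rewrite leNgt zx.
  by apply: minx; split=> //; apply: le_trans xy; exact: ltW.
have ex z : z < x -> exists u, [/\ D u, h z < h u, z < u & u < x].
  move=> zx; have [_ [[u Du <-] zu uc]] := Dc _ (below _ zx).
  have um : u <= m by apply: le_trans ym; apply/ltW/Dy.
  exists u; split=> //.
    by apply: h_lt zu => //; apply: le_trans xm; exact: ltW.
  by apply: h_lt => //; exact: lt_le_trans cx.
have x0 : seg x !=set0.
  have [e ec] := c0; have [_ [[u Du <-] zu uc]] := Dc _ ec.
  have um : u <= m by apply: le_trans ym; apply/ltW/Dy.
  by exists u; apply: h_lt => //; exact: lt_le_trans cx.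
have aDx : acc D x by split=> // z /ex [u [Du _ zu ux]]; exists u.
have lx := acc_limit aDx.
have hxc : h x = c.
  apply/eqP; rewrite eq_le cx andbT leNgt; apply/negP => /(h_cont xm lx) [z zx cz].
  by move: (below _ zx); rewrite ltNge (ltW cz).
exists x; split=> //.
  by rewrite lt_neqAle xy andbT; apply/eqP => xy'; move: cy; rewrite -xy' hxc ltxx.
by split=> // z /below; rewrite hxc.
Qed.

Definition pull S : set O := [set x | strict_limit x /\ S (h x)].

Lemma img_cofinal y D : y <= m -> strict_limit y -> cofinal_in y D ->
  cofinal_in (h y) (h @` D).
Proof.
move=> ym [ly sy] [Dy cD]; split=> [_ [x Dx <-]|b /(h_cont ym ly) [z zy bz]].
  by apply: sy; exact: Dy.
have [u Du zu] := cD _ zy; exists (h u); first by exists u.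
apply: le_trans (ltW bz) _; apply: h_mono zu _.
by apply: le_trans ym; apply/ltW/Dy.
Qed.

Lemma stationary_pull y S : y <= m -> strict_limit y -> ucof (h y) ->
  stationary_in (h y) (S `&` seg (h y)) ->
  stationary_in y (pull S `&` seg y).
Proof.
move=> ym sy uy [_ St]; split=> [x []//|D [cD clD]].
have cI := img_cofinal ym sy cD.
(* A limit point of the image is chosen, not merely a point of it: it has a preimage that is a
   strict limit and a limit of [D]. *)
have [c [[Sc cy] [[Dc _] _]]] := St _ (club_acc uy cI cI).
have [x [xy sx hx aD]] := acc_img_preimage ym cD.1 cy Dc.
exists x; split; last exact: closed_acc clD xy aD.
by split=> //; split=> //; rewrite hx.
Qed.

Lemma stationary_push y S : y <= m -> strict_limit y -> ucof (h y) ->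
  stationary_in y (pull S `&` seg y) ->
  stationary_in (h y) (S `&` seg (h y)).
Proof.
move=> ym sy uy [_ St]; split=> [x []//|C [cC clC]].
have [ly hy] := sy.
(* For [x] in [E], continuity makes [C] unbounded in [h x], so [h x] lies in [C]. *)
pose E := [set x | [/\ x < y, limit_ordinal x & forall z, z < x ->
  exists c, [/\ C c, h z < c & c < h x]]].
have clE : club_in y E.
  split.
    split=> [x []//|z zy].
    have cT : cofinal_in y (seg y) by split=> // b yb; exists b.
    have cI := img_cofinal ym sy cT.
    have lhy := strict_limit_img ym sy.
    have cclub := club_acc uy cC cI.
    (* A common limit of [C] and of the values of [h] below [y] is some [h x] with [x] a strict
       limit; this [x] belongs to [E]. *)
    have [c [[[Cc Ic] cy] zc _]] := cofinal_gt lhy cclub.1 (hy _ zy).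
    have [x [xy sx hx _]] := acc_img_preimage ym cT.1 cy Ic.
    have xm : x <= m by apply: le_trans ym; exact: ltW.
    exists x.
      split=> //; first exact: sx.1.
      by move=> t /sx.2; rewrite hx => /Cc.2.
    by apply/ltW/h_lt => //; [apply: le_trans ym; exact: ltW | rewrite hx].
  move=> x xy lx cx; have aE := cofinal_acc lx cx.
  split=> // z /aE.2 [u [[_ _ uE] zu ux]].
  have [c [Cc zc cu]] := uE _ zu; exists c; split=> //.
  by apply: lt_le_trans cu _; apply: h_mono (ltW ux) _; apply: le_trans ym; exact: ltW.
have [x [[[sx Sx] xy] [_ lx xE]]] := St _ clE.
have xm : x <= m by apply: le_trans ym; exact: ltW.
exists (h x); split; first by split=> //; exact: hy.
apply: closed_acc clC (hy _ xy) _; split; first exact: (strict_limit_img xm sx).1.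
move=> b /(h_cont xm lx) [z zx bz].
have [c [Cc zc cx]] := xE _ zx.
by exists c; split=> //; exact: lt_trans zc.
Qed.

End Continuous.

(* The running supremum of a cofinal map [m -> a]; it is only weakly increasing,
   which is why points are restricted to [strict_limit]. *)
Lemma continuous_cofinal_map a m : limit_ordinal a -> limit_ordinal m ->
  cofinality a m -> exists h : O -> O, [/\ h m = a,
    forall x y, x <= y -> y <= m -> h x <= h y,
    forall x b, x <= m -> limit_ordinal x -> b < h x -> exists2 z, z < x & b < h z
    & strict_limit h m].
Proof.
move=> la lm [[g [ga gc]] mmin].
have ga' z : z < m -> g z < a by move=> zm; apply: ga; exists z.
have hP x : exists b, x <= m ->
    (forall z, z < x -> g z <= b) /\ (forall y, (forall z, z < x -> g z <= y) -> b <= y).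
  have [xm|xm] := leP x m; last by exists x.
  have [|b ub minb] := wo_least (A := fun b => forall z, z < x -> g z <= b).
    by exists a => z zx; apply/ltW/ga'; exact: lt_le_trans xm.
  by exists b.
have [h hh] := choice hP.
have gt x b : x <= m -> b < h x -> exists2 z, z < x & b < g z.
  move=> xm bx; apply: contrapT => nz.
  suff : h x <= b by rewrite leNgt bx.
  apply: (hh _ xm).2 => z zx; rewrite leNgt; apply/negP => bz.
  by apply: nz; exists z.
have mono x y : x <= y -> y <= m -> h x <= h y.
  move=> xy ym; apply: (hh _ (le_trans xy ym)).2 => z zx.
  by apply: (hh _ ym).1; exact: lt_le_trans xy.
have hma : h m = a.
  apply/eqP; rewrite eq_le; apply/andP; split.
    by apply: (hh _ (lexx _)).2 => z /ga' /ltW.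
  rewrite leNgt; apply/negP => ma.
  (* [g] passes a given bound only weakly, so the bound is taken strictly above [h m]. *)
  have [c mc ca] := la.2 _ ma.
  have [_ [z zm <-] cz] := gc _ ca.
  have : h m < h m by apply: lt_le_trans mc (le_trans cz _); exact: (hh _ (lexx _)).1.
  by rewrite ltxx.
exists h; split=> //.
  move=> x b xm lx /(gt _ _ xm) [z zx bz].
  (* [h c] bounds [g] only strictly below [c], hence the passage from [z] to a larger [c]. *)
  have [c zc cx] := lx.2 _ zx; exists c => //.
  apply: lt_le_trans bz _; apply: (hh _ _).1 => //.
  by apply: le_trans xm; exact: ltW.
split=> // z zm; rewrite lt_neqAle (mono _ _ (ltW zm)) // andbT.
apply/eqP => hz.
(* If [h] had already reached [a] at [z], then [g] restricted to [seg z] would be cofinal. *)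
suff /mmin : has_cofinal_map a z by rewrite leNgt zm.
exists g; split=> [_ [t tz <-]|b ba]; first by apply: ga'; exact: lt_trans zm.
have [|t tz bt] := gt z b (ltW zm); first by rewrite hz hma.
by exists (g t); [exists t | exact: ltW].
Qed.

End WellOrder.

(** * The two implications between reflection principles *)

Theorem theorem5 (d : Order.disp_t) (O : orderType d)
    (O_wo : well_order (<=%O : rel O)) (kappa lambda mu nu : O)
    (reg_kappa : regular_cardinal kappa) (reg_lambda : regular_cardinal lambda)
    (reg_mu : regular_cardinal mu) (reg_nu : regular_cardinal nu)
    (lt_kappa_lambda : (kappa < lambda)%O) (lt_lambda_mu : (lambda < mu)%O)
    (lt_mu_nu : (mu < nu)%O) :
  (Ref nu mu lambda -> Ref nu lambda kappa -> Ref nu mu kappa) /\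
  (Ref nu mu kappa -> Ref mu lambda kappa -> Ref nu lambda kappa).
Proof.
have [_ inf_kappa _] := reg_kappa.
have lt_kappa_mu : kappa < mu by exact: lt_trans lt_lambda_mu.
have ucof_lambda a : cofinality a lambda -> ucof a.
  exact: cofinality_ucof inf_kappa lt_kappa_lambda.
have ucof_mu a : cofinality a mu -> ucof a.
  exact: cofinality_ucof inf_kappa lt_kappa_mu.
have ucof_nu : ucof nu.
  have [_ _ cf_nu] := reg_nu.
  exact: cofinality_ucof inf_kappa (lt_trans lt_kappa_mu lt_mu_nu) cf_nu.
split=> ref1 ref2 S sS St.
- pose T := [set b | Tcof nu lambda b /\ stationary_in b (S `&` seg b)].
  have [||a Ta Sta] := ref1 T; [by move=> b [] | split | ].
  + by move=> b [[]].
  + move=> C clubC.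
    (* Reflecting [S] intersected with [C], rather than [S], makes [b] a limit of [C], hence a point
       of [C]. *)
    have [|b Tb StSCb] := ref2 _ _ (stationaryIclub O_wo ucof_nu St clubC).
      by move=> x [/sS].
    have ub := ucof_lambda _ Tb.2.
    have Stb : stationary_in b (S `&` seg b).
      split=> [x []//|D /StSCb.2 [x [[[Sx Cx] xb] Dx]]].
      by exists x.
    exists b; split; first by split.
    apply: closed_acc clubC.2 Tb.1 _.
    have aSC := cofinal_acc (ucof_limit ub) (stationary_cofinal StSCb).
    by apply: sub_acc aSC => x [].
  + exists a => //; apply: stationary_trace Sta => //; first exact: ucof_mu Ta.2.
    by move=> b [Tb Stb]; split=> //; exact: ucof_lambda Tb.2.
- have [a Ta Sta] := ref1 _ sS St.
  have ua := ucof_mu _ Ta.2.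
  have [_ _ cf_mu] := reg_mu.
  have [h [hmu h_mono h_cont smu]] :=
    continuous_cofinal_map O_wo (ucof_limit ua) (ucof_limit (ucof_mu _ cf_mu)) Ta.2.
  subst a.
  have Stp := stationary_pull O_wo h_mono h_cont (lexx mu) smu ua Sta.
  have [|y Ty Sty] := ref2 _ _ Stp.
    move=> x [[sx /sS [_ cx]] xm]; split=> //.
    exact/(cofinality_img h_mono h_cont kappa (ltW xm) sx).
  have ym := ltW Ty.1.
  (* The set reflected at [y] is unbounded in [y] and consists of strict limits. *)
  have sy : strict_limit h y.
    apply: strict_limit_closed h_mono _ ym _.
    have ay := cofinal_acc (ucof_limit (ucof_lambda _ Ty.2)) (stationary_cofinal Sty).
    by apply: sub_acc ay => x [[]].
  have cy : cofinality (h y) lambda.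
    exact/(cofinality_img h_mono h_cont lambda ym sy)/Ty.2.
  have hy : h y < h mu by exact: smu.2 Ty.1.
  exists (h y); first by split=> //; exact: lt_trans Ta.1.
  apply: (stationary_push O_wo h_mono h_cont ym sy (ucof_lambda _ cy)).
  (* [Sty] concerns a trace also cut at [mu]; dropping that cut only enlarges the set. *)
  split=> [x []//|C /Sty.2 [x [[[Sx _] xy] Cx]]].
  by exists x.
Qed.
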